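(* Let $r\ge2$, $d\in\{1,\dots,r-1\}$ and $M\in\mathrm{rep}_{\mathrm{proj}}(K_r,d)$. Then $\dim_k\ker\psi_M\le(r-d)\bigl(\dim_kM_1-\min\{\dim_kM_1,d\}\bigr)$. In particular, $\Delta_M(d)\ge(r-d)\min\{\dim_kM_1,d\}$.
   Context: $k$ algebraically closed of arbitrary characteristic; vector spaces finite-dimensional. $K_r$ is the Kronecker quiver with arrows $\gamma_1,\dots,\gamma_r:1\to2$; $A_r=\bigoplus_ik\gamma_i$; for a representation $M=(M_1,M_2,(M(\gamma_i))_i)$, $\psi_M:A_r\otimes_kM_1\to M_2$, $\gamma_i\otimes m\mapsto M(\gamma_i)(m)$. $\Delta_M(d)=\dim_kM_2-d\dim_kM_1$. $\mathrm{rep}_{\mathrm{proj}}(K_r,d)$ is the full subcategory of representations $M$ such that the restriction of $\psi_M$ to $\mathfrak v\otimes_kM_1$ is injective for every $d$-dimensional subspace $\mathfrak v\subseteq A_r$. *)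

(* Defs.v *)
From HB Require Import structures.
From mathcomp Require Import all_boot all_order all_algebra.
Set Implicit Arguments. Unset Strict Implicit. Unset Printing Implicit Defensive.
Import GRing.Theory.
Local Open Scope ring_scope.

(* A representation M of the Kronecker quiver K_r with M_1 = k^m, M_2 = k^n
   (row vectors) is given by r matrices A i : 'M_(m,n), with
   M(gamma_i)(x) = x *m A i.
   A_r (x) M_1 is identified with 'M[k]_(r,m): the i-th row of X is the
   M_1-component along gamma_i, i.e. X = \sum_i gamma_i (x) row i X. *)
Definition psi (k : fieldType) (r m n : nat) (A : 'I_r -> 'M[k]_(m, n))
  (X : 'M[k]_(r, m)) : 'rV[k]_n :=
  \sum_(i < r) row i X *m A i.

(* M in rep_proj(K_r,d): for every d-dimensional subspace v of A_r, spanned by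
   the (linearly independent) rows of V : 'M_(d,r), psi restricted to
   v (x) M_1 is injective.  Elements of v (x) M_1 are exactly
   \sum_j (row j V) (x) y_j, i.e. the matrices V^T *m Y with Y : 'M_(d,m),
   and Y |-> V^T *m Y is a bijection onto v (x) M_1. *)
Definition rep_proj (k : fieldType) (r m n d : nat) (A : 'I_r -> 'M[k]_(m, n)) :=
  forall V : 'M[k]_(d, r), row_free V ->
  forall Y : 'M[k]_(d, m), psi A (V^T *m Y) = 0 -> Y = 0.

Definition Delta (m n d : nat) : int := (n%:Z - (d * m)%:Z)%R.

(* Main.v *)
Require Import Defs.
From HB Require Import structures.
From mathcomp Require Import all_boot all_order all_fingroup all_algebra zify.
Set Implicit Arguments. Unset Strict Implicit. Unset Printing Implicit Defensive.
Import GRing.Theory Num.Theory.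
Local Open Scope ring_scope.

(* The kernel W of psi meets the cone Z of matrices of rank at most d only in 0,
   and this forces codim W >= dim Z = d(r+m-d) =: D when d <= m.  Choose linear
   coordinates such that W is cut out by the first c = codim W of them.
   Projecting Z successively along the other coordinates, each is integral over
   the previous ones, since the cone Z misses the center of projection, and the
   image stays closed by elimination.  Hence the polynomial functions of degree
   at most e on Z span a space of dimension O(e^c).  On the other hand the D
   entries lying in the first d rows or columns are algebraically independent on
   Z, so that this dimension grows at least like e^D. *)

(** * Polynomial functions *)

Section PolynomialFunctions.
Variables (k : fieldType) (n : nat).
Implicit Types (x y : 'rV[k]_n) (f g : 'rV[k]_n -> k).

(* [polyf hom s e f]: f is a polynomial function of the coordinates of index
   < s, homogeneous of degree e if hom is true, of degree at most e if not. *)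
Inductive polyf (hom : bool) (s : nat) : nat -> ('rV[k]_n -> k) -> Prop :=
| polyf_const e c : (hom -> e = 0%N \/ c = 0) -> polyf hom s e (fun=> c)
| polyf_coord (i : 'I_n) e f : (i < s)%N -> polyf hom s e f ->
    polyf hom s e.+1 (fun x => x 0 i * f x)
| polyf_add e f g : polyf hom s e f -> polyf hom s e g ->
    polyf hom s e (fun x => f x + g x)
| polyf_ext e f g : polyf hom s e f -> f =1 g -> polyf hom s e g.

(** Equality of the images of [x] and [y] under the projection to the first [s] coordinates; the
    projection itself is never formed. *)
Definition agree s x y := forall i : 'I_n, (i < s)%N -> x 0 i = y 0 i.

Lemma polyf0 hom s e : polyf hom s e (fun=> 0).
Proof. by apply: polyf_const; right. Qed.

Lemma polyf_scale hom s e c f :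
  polyf hom s e f -> polyf hom s e (fun x => c * f x).
Proof.
elim=> {e f} [e a ha|i e f lt_is _ IH|e f g _ IHf _ IHg|e f g _ IH fg].
- by apply: polyf_const => /ha[]->; [left|right; rewrite mulr0].
- by apply: polyf_ext (polyf_coord lt_is IH) _ => x; rewrite mulrCA.
- by apply: polyf_ext (polyf_add IHf IHg) _ => x; rewrite mulrDr.
- by apply: polyf_ext IH _ => x; rewrite fg.
Qed.

Lemma polyf_le s e e' f :
  polyf false s e f -> (e <= e')%N -> polyf false s e' f.
Proof.
move=> pf; elim: pf e' => {e f} [e a _|i e f lt_is _ IH
  |e f g _ IHf _ IHg|e f g _ IH fg] e' le_e.
- exact: polyf_const.
- by case: e' le_e => // e' le_e; apply: polyf_coord => //; apply: IH.
- by apply: polyf_add; [apply: IHf|apply: IHg].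
- by apply: polyf_ext fg; apply: IH.
Qed.

Lemma polyf_mul hom s e e' f g : polyf hom s e f -> polyf hom s e' g ->
  polyf hom s (e + e') (fun x => f x * g x).
Proof.
move=> pf pg; elim: pf => {e f} [e a ha|i e f lt_is _ IH
  |e f f' _ IHf _ IHf'|e f f' _ IH ff'].
- case: hom ha pg => [/(_ isT) ha|_] pg.
    case: ha => ->; first exact: polyf_scale.
    by apply: polyf_ext (polyf0 _ _ _) _ => x; rewrite mul0r.
  by apply: polyf_le (leq_addl _ _); apply: polyf_scale.
- by apply: polyf_ext (polyf_coord lt_is IH) _ => x; rewrite mulrA.
- by apply: polyf_ext (polyf_add IHf IHf') _ => x; rewrite mulrDl.
- by apply: polyf_ext IH _ => x; rewrite ff'.
Qed.

Lemma polyf_sum hom s e (I : Type) (r : seq I) (P : pred I)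
    (F : I -> 'rV[k]_n -> k) :
  (forall i, P i -> polyf hom s e (F i)) ->
  polyf hom s e (fun x => \sum_(i <- r | P i) F i x).
Proof.
move=> pF; elim: r => [|i r IH].
  by apply: polyf_ext (polyf0 _ _ _) _ => x; rewrite big_nil.
have [Pi|nPi] := boolP (P i).
  by apply: polyf_ext (polyf_add (pF _ Pi) IH) _ => x; rewrite big_cons Pi.
by apply: polyf_ext IH _ => x; rewrite big_cons (negPf nPi).
Qed.

Lemma polyf_prod hom s (I : Type) (r : seq I) (e : I -> nat)
    (F : I -> 'rV[k]_n -> k) :
  (forall i, polyf hom s (e i) (F i)) ->
  polyf hom s (\sum_(i <- r) e i) (fun x => \prod_(i <- r) F i x).
Proof.
move=> pF; elim: r => [|i r IH].
  rewrite big_nil; apply: (@polyf_ext _ _ _ (fun=> 1)); last first.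
    by move=> x; rewrite big_nil.
  by apply: polyf_const; left.
rewrite big_cons; apply: polyf_ext (polyf_mul (pF i) IH) _ => x.
by rewrite big_cons.
Qed.

Lemma polyf_exp hom s e f a : polyf hom s e f ->
  polyf hom s (a * e) (fun x => f x ^+ a).
Proof.
move=> pf; elim: a => [|a IH]; first by apply: polyf_const; left.
by rewrite mulSn; apply: polyf_ext (polyf_mul pf IH) _ => x; rewrite exprS.
Qed.

Lemma polyf_det hom s e p (M : 'rV[k]_n -> 'M[k]_p) :
  (forall i j, polyf hom s e (fun x => M x i j)) ->
  polyf hom s (p * e) (fun x => \det (M x)).
Proof.
move=> pM; apply: polyf_sum => sg _; apply: polyf_scale.
have := @polyf_prod hom s _ (index_enum 'I_p) (fun=> e)
   (fun i x => M x i (sg i)) (fun i => pM i (sg i)).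
by rewrite sum_nat_const card_ord.
Qed.

Lemma polyf_agree hom s e f x y :
  polyf hom s e f -> agree s x y -> f x = f y.
Proof.
move=> pf xy; elim: pf => {e f} //.
- by move=> i e f lt_is _ ->; rewrite xy.
- by move=> e f g _ -> _ ->.
- by move=> e f g _ fxy fg; rewrite -!fg.
Qed.

Lemma polyf_homog s e f a x :
  polyf true s e f -> f (a *: x) = a ^+ e * f x.
Proof.
elim=> {e f} //.
- by move=> e c /(_ isT)[]->; rewrite ?mul1r ?mulr0.
- by move=> i e f lt_is _ ->; rewrite mxE exprS mulrACA.
- by move=> e f g _ -> _ ->; rewrite mulrDr.
- by move=> e f g _ fxy fg; rewrite -!fg.
Qed.

Lemma polyf_forget s e f : polyf true s e f -> polyf false s e f.
Proof.
elim=> {e f}.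
- by move=> e c _; apply: polyf_const.
- by move=> i e f lt_is _ IH; apply: polyf_coord.
- by move=> e f g _ IHf _ IHg; apply: polyf_add.
- by move=> e f g _ IH fg; apply: polyf_ext fg.
Qed.

(** When [hom] is true, the coefficient of the power [e] has degree 0 and is therefore constant;
    monic equations arise from this. *)
Lemma polyf_coefs hom s (i0 : 'I_n) e f : i0 = s :> nat ->
  polyf hom s.+1 e f ->
  exists g : nat -> 'rV[k]_n -> k,
    (forall j, (j <= e)%N -> polyf hom s (e - j) (g j)) /\
    forall x, f x = \sum_(j < e.+1) g j x * x 0 i0 ^+ j.
Proof.
move=> i0s; elim=> {e f} [e a ha|i e f lt_is _ [g [pg fE]]
  |e f f' _ [g [pg fE]] _ [g' [pg' fE']]|e f f' _ [g [pg fE]] ff'].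
- exists (fun j x => if j == 0%N then a else 0); split.
    case=> [|j] le_j; last exact: polyf0.
    by rewrite subn0; apply: polyf_const.
  by move=> x; rewrite big_ord_recl big1 ?addr0 ?mulr1 // => j _; rewrite mul0r.
- have [/eqP is0|is0] := boolP (i == s :> nat).
    have -> : i = i0 by apply: val_inj; rewrite /= is0.
    exists (fun j x => if j is j'.+1 then g j' x else 0); split.
      by case=> [|j] le_j; [apply: polyf0|apply: pg].
    move=> x; rewrite fE [RHS]big_ord_recl /= mul0r add0r mulr_sumr.
    by apply: eq_bigr => j _; rewrite mulrCA exprS.
  have lt_i : (i < s)%N by lia.
  exists (fun j x => if j == e.+1 then 0 else x 0 i * g j x); split.
    move=> j le_j; case: eqP => [_|ne_j]; first exact: polyf0.
    have -> : (e.+1 - j = (e - j).+1)%N by lia.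
    by apply: polyf_coord => //; apply: pg; lia.
  move=> x; rewrite big_ord_recr /= eqxx mul0r addr0 fE mulr_sumr.
  by apply: eq_bigr => j _; rewrite ifN ?mulrA //; have := ltn_ord j; lia.
- exists (fun j x => g j x + g' j x); split.
    by move=> j le_j; apply: polyf_add; [apply: pg|apply: pg'].
  by move=> x; rewrite fE fE' -big_split; apply: eq_bigr => j _; rewrite mulrDl.
- by exists g; split=> // x; rewrite -ff'.
Qed.

Lemma polyf_components s e f : polyf false s e f ->
  exists g : nat -> 'rV[k]_n -> k,
    (forall j, polyf true s j (g j)) /\
    forall x, f x = \sum_(j < e.+1) g j x.
Proof.
elim=> {e f} [e a _|i e f lt_is _ [g [pg fE]]
  |e f f' _ [g [pg fE]] _ [g' [pg' fE']]|e f f' _ [g [pg fE]] ff'].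
- exists (fun j x => if j == 0%N then a else 0); split.
    by case=> [|j]; [apply: polyf_const; left|apply: polyf0].
  by move=> x; rewrite big_ord_recl big1 ?addr0.
- exists (fun j x => if j is j'.+1 then x 0 i * g j' x else 0); split.
    by case=> [|j]; [apply: polyf0|apply: polyf_coord].
  by move=> x; rewrite fE [RHS]big_ord_recl /= add0r mulr_sumr.
- exists (fun j x => g j x + g' j x); split.
    by move=> j; apply: polyf_add.
  by move=> x; rewrite fE fE' -big_split.
- by exists g; split=> // x; rewrite -ff'.
Qed.

(** For functions whose degree does not matter, such as the eliminant. *)
Definition regular s f := exists e, polyf false s e f.

Lemma regular_ext s f g : regular s f -> f =1 g -> regular s g.
Proof. by case=> e pf fg; exists e; apply: polyf_ext fg. Qed.

Lemma regular_const s c : regular s (fun=> c).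
Proof. by exists 0%N; apply: polyf_const. Qed.

Lemma regular_add s f g :
  regular s f -> regular s g -> regular s (fun x => f x + g x).
Proof.
move=> [e pf] [e' pg]; exists (e + e')%N.
by apply: polyf_add; apply: polyf_le; [exact: pf|lia|exact: pg|lia].
Qed.

Lemma regular_mul s f g :
  regular s f -> regular s g -> regular s (fun x => f x * g x).
Proof. by move=> [e pf] [e' pg]; exists (e + e')%N; apply: polyf_mul. Qed.

Lemma regular_sum s (I : Type) (r : seq I) (F : I -> 'rV[k]_n -> k) :
  (forall i, regular s (F i)) -> regular s (fun x => \sum_(i <- r) F i x).
Proof.
move=> pF; elim: r => [|i r IH].
  by apply: regular_ext (regular_const s 0) _ => x; rewrite big_nil.
by apply: regular_ext (regular_add (pF i) IH) _ => x; rewrite big_cons.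
Qed.

Lemma regular_prod s (I : Type) (r : seq I) (F : I -> 'rV[k]_n -> k) :
  (forall i, regular s (F i)) -> regular s (fun x => \prod_(i <- r) F i x).
Proof.
move=> pF; elim: r => [|i r IH].
  by apply: regular_ext (regular_const s 1) _ => x; rewrite big_nil.
by apply: regular_ext (regular_mul (pF i) IH) _ => x; rewrite big_cons.
Qed.

Lemma regular_det s p (M : 'rV[k]_n -> 'M[k]_p) :
  (forall i j, regular s (fun x => M x i j)) ->
  regular s (fun x => \det (M x)).
Proof.
move=> pM; apply: regular_sum => sg.
by apply: regular_mul; [apply: regular_const|apply: regular_prod].
Qed.

End PolynomialFunctions.

(** * Elimination *)

(** The field is infinite: the product of the ['X - y%:P] over [l] is a nonzero polynomial, so it
    has a nonroot. *)
Lemma closed_field_notin (k : closedFieldType) (l : seq k) :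
  exists c, c \notin l.
Proof.
have /closed_nonrootP[c] : \prod_(y <- l) ('X - y%:P) != 0.
  by apply: monic_neq0; apply: monic_prod_XsubC.
by rewrite root_prod_XsubC; exists c.
Qed.

Lemma eigenvector_horner_mx (k : fieldType) n (A : 'M[k]_n.+1) v a p :
  v *m A = a *: v -> v *m horner_mx A p = p.[a] *: v :> 'rV_n.+1.
Proof.
move=> vA; elim/poly_ind: p => [|p c IH].
  by rewrite raddf0 mulmx0 horner0 scale0r.
rewrite rmorphD rmorphM /= horner_mx_X horner_mx_C mulmxDr mulmxA IH.
by rewrite -scalemxAl vA scalerA mul_mx_scalar -scalerDl !hornerE.
Qed.

(** The size of [companionmx p] depends on [p]. With a fixed size [n], the companion matrix of a
    family of polynomials can be a function of the point. *)
Lemma char_poly_companion (R : comNzRingType) n (A : 'M[R]_n) (p : {poly R}) :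
  p \is monic -> size p = n.+1 ->
  (forall i j, A i j = if i == n.-1 :> nat then - p`_j
                       else (i.+1 == j :> nat)%:R) ->
  char_poly A = p.
Proof.
move=> mp szp AE; have nE : n = (size p).-1 by rewrite szp.
rewrite -[RHS](companionmxK mp); move: A AE; rewrite {szp}nE => A AE.
by congr char_poly; apply/matrixP => i j; rewrite AE mxE.
Qed.

Section Elimination.
Variables (k : closedFieldType) (n : nat) (Z : 'rV[k]_n -> Prop).
Hypotheses (Z0 : Z 0) (Zcone : forall a x, Z x -> Z (a *: x)).

(* The image of Z in the first s coordinates is Zariski closed. *)
Definition closed_image s := forall q, (forall x, Z x -> ~ agree s x q) ->
  exists e f, [/\ polyf true s e.+1 f, forall x, Z x -> f x = 0 & f q != 0].

(** Induction on [ps]: if [f] works for [ps] but vanishes at [p], and [g] is nonzero at [p], then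
    [g + c f] works for all points once [c] avoids the finitely many quotients [- g p' / f p']. The
    degrees may differ, so homogeneity is lost. *)
Lemma closed_image_avoid s (ps : seq 'rV[k]_n) : closed_image s ->
  (forall p, p \in ps -> forall x, Z x -> ~ agree s x p) ->
  exists f, [/\ regular s f, forall x, Z x -> f x = 0
    & forall p, p \in ps -> f p != 0].
Proof.
move=> clZ; elim: ps => [|p ps IH] nZ.
  by exists (fun=> 0); split=> //; apply: regular_const.
have [|f [rf fZ fps]] := IH; first by move=> p' ps'; apply: nZ; rewrite inE ps' orbT.
have [|e [g [pg gZ gp]]] := clZ p; first by apply: nZ; rewrite mem_head.
have [c] := closed_field_notin [seq - g p' / f p' | p' <- ps].
have [fp0|fp0] := eqVneq (f p) 0 => c_avoid; last first.
  exists f; split=> // p'; rewrite inE => /predU1P[-> //|]; exact: fps.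
exists (fun x => g x + c * f x); split.
- apply: regular_add; first by exists e.+1; apply: polyf_forget.
  by apply: regular_mul => //; apply: regular_const.
- by move=> x Zx; rewrite fZ // gZ // mulr0 addr0.
- move=> p'; rewrite inE => /predU1P[->|ps'].
    by rewrite fp0 mulr0 addr0.
  apply: contra c_avoid => /eqP gf; apply/mapP; exists p' => //.
  apply: (mulIf (fps _ ps')); rewrite divfK ?fps //.
  by apply/eqP; rewrite -subr_eq0 opprK addrC gf.
Qed.

(** For [x] in the cone, [h (a *: x)] is a polynomial in [a] that vanishes identically, so each
    homogeneous component of [h] vanishes on [Z]. The constant component is zero because [Z]
    contains 0, so a component nonzero at [q] has positive degree. *)
Lemma regular_component s h q : regular s h -> (forall x, Z x -> h x = 0) ->
  h q != 0 ->
  exists e f, [/\ polyf true s e.+1 f, forall x, Z x -> f x = 0 & f q != 0].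
Proof.
move=> [e /polyf_components[g [pg hE]]] hZ hq.
have gZ x (j : 'I_e.+1) : Z x -> g j x = 0.
  move=> Zx; have P0 : \poly_(j < e.+1) g j x = 0.
    apply/eqP; apply: contraT => /closed_nonrootP[a /negP[]].
    rewrite /root horner_poly; apply/eqP; rewrite -[RHS](hZ _ (Zcone a Zx)) hE.
    by apply: eq_bigr => i _; rewrite (polyf_homog _ _ (pg i)) mulrC.
  by have := congr1 (fun p : {poly k} => p`_j) P0; rewrite coef_poly coef0 ltn_ord.
have [j gq] : exists j : 'I_e.+1, g j q != 0.
  apply/existsP; apply: contraR hq; rewrite negb_exists => /forallP g0.
  by rewrite hE big1 // => i _; apply/eqP; rewrite -[_ == _]negbK g0.
case: j => [[|j] lt_j] /= in gq.
  case/negP: gq; rewrite -[g 0%N q]mul1r -[1](expr0 0) -(polyf_homog _ _ (pg 0%N)).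
  by rewrite scale0r (gZ 0 ord0).
by exists j, (g j.+1); split=> // x Zx; apply: (gZ x (Ordinal lt_j)).
Qed.

Section Projection.
Variables (s : nat) (i0 : 'I_n).
Hypothesis i0s : i0 = s :> nat.
Hypothesis ZL : forall x, Z x -> agree s x 0 -> x 0 i0 = 0.

(** The unit vector [p] along coordinate [s] is the center of projection, and by [ZL] no point of
    [Z] lies over it. A form vanishing on [Z] but not at [p] is, up to the scalar [f p], monic in
    that coordinate. *)
Lemma coordinate_integral : closed_image s.+1 ->
  exists E g, (forall j, (j < E.+1)%N -> polyf false s E.+1 (g j)) /\
    forall x, Z x -> x 0 i0 ^+ E.+1 + \sum_(j < E.+1) g j x * x 0 i0 ^+ j = 0.
Proof.
move=> clZ; pose p : 'rV[k]_n := \row_i (i == i0)%:R.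
have [x Zx xp|E [f [pf fZ fp]]] := clZ p.
  have := ZL Zx; rewrite xp ?i0s // mxE eqxx => /(_ _)/eqP.
  rewrite oner_eq0; suff h : agree s x 0 by move/(_ h).
  move=> i lt_is; rewrite xp ?ltnS 1?ltnW // !mxE.
  by case: eqP => // ii0; move: lt_is; rewrite ii0 i0s ltnn.
have [g [pg fE]] := polyf_coefs i0s pf.
(* The first [s] coordinates of [p] are zero and [g j] is homogeneous of positive degree. *)
have gp j : (j < E.+1)%N -> g j p = 0.
  move=> lt_j; have -> : g j p = g j (0 *: p).
    apply: (polyf_agree (pg _ (ltnW lt_j))) => i lt_is; rewrite !mxE mul0r.
    by case: eqP => // ii0; move: lt_is; rewrite ii0 i0s ltnn.
  by rewrite (polyf_homog _ _ (pg _ (ltnW lt_j))) expr0n subn_eq0 leqNgt lt_j mul0r.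
have gE x : g E.+1 x = f p.
  have pgE := pg _ (leqnn E.+1); rewrite subnn in pgE.
  rewrite fE big_ord_recr /= big1 => [|j _]; last by rewrite gp ?mul0r.
  rewrite mxE eqxx expr1n mulr1 add0r.
  by rewrite -[LHS]mul1r -[RHS]mul1r -(expr0 0) -!(polyf_homog _ _ pgE) !scale0r.
exists E, (fun j x => (f p)^-1 * g j x); split.
  move=> j lt_j; apply: polyf_scale; apply: polyf_le (leq_subr j _).
  by apply: polyf_forget; apply: pg; apply: ltnW.
move=> x Zx; apply: (mulfI fp); rewrite mulr0 mulrDr mulr_sumr addrC.
rewrite -[RHS](fZ _ Zx) [in RHS]fE [in RHS]big_ord_recr /= gE; congr (_ + _).
by apply: eq_bigr => j _; rewrite !mulrA divff // mul1r.
Qed.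

(* The eliminant is the determinant of G evaluated at the companion matrix C of
   the monic equation F of the last coordinate, where G vanishes on Z but at no
   root of F over q. *)
Lemma closed_image_step E g :
  (forall j, (j < E.+1)%N -> polyf false s E.+1 (g j)) ->
  (forall x, Z x -> x 0 i0 ^+ E.+1 + \sum_(j < E.+1) g j x * x 0 i0 ^+ j = 0) ->
  closed_image s.+1 -> closed_image s.
Proof.
move=> pg gZ clZ q nZq.
pose F x : {poly k} := 'X^(E.+1) + \poly_(j < E.+1) g j x.
have szF x : size (F x) = E.+2.
  by rewrite size_polyDl size_polyXn // ltnS size_poly.
have monF x : F x \is monic.
  by rewrite monicE lead_coefDl ?lead_coefXn // size_polyXn ltnS size_poly.
have FE x t : (F x).[t] = t ^+ E.+1 + \sum_(j < E.+1) g j x * t ^+ j.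
  by rewrite hornerD hornerXn horner_poly.
pose C x := \matrix_(i < E.+1, j < E.+1)
  if (i == E :> nat) then - g j x else (i.+1 == j :> nat)%:R.
have charC x : char_poly (C x) = F x.
  apply: char_poly_companion => // i j; rewrite mxE.
  by have -> : (F x)`_j = g j x
    by rewrite coefD coefXn coef_poly ltn_ord (ltn_eqF (ltn_ord j)) add0r.
pose upd t : 'rV[k]_n := \row_i if i == i0 then t else q 0 i.
have upd_q t : agree s (upd t) q.
  move=> i lt_is; rewrite mxE; case: eqP => // ii0.
  by move: lt_is; rewrite ii0 i0s ltnn.
have [r Fq] := closed_field_poly_normal (F q).
(* The points over [q] whose next coordinate is a root of [F q] are not in the image of [Z], since
   [q] is not; a single [G] is nonzero at all of them. *)
have [|G [[e pG] GZ Gr]] := @closed_image_avoid s.+1 (map upd r) clZ.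
  move=> _ /mapP[t _ ->] x Zx xt; apply: (nZq x Zx) => i lt_is.
  by rewrite xt ?upd_q // ltnS ltnW.
have [c [pc GE]] := polyf_coefs i0s pG.
pose Gp x := \poly_(j < e.+1) c j x.
(* Up to sign, the resultant of [F x] and [Gp x]. *)
pose h x := \det (horner_mx (C x) (Gp x)).
apply: (@regular_component s h).
- apply: regular_det => i j.
  have rC i' j' : regular s (fun x => C x i' j').
    apply: (@regular_ext _ _ _ (fun x => if i' == E :> nat then -1 * g j' x
       else (i'.+1 == j' :> nat)%:R)); last by move=> x; rewrite mxE mulN1r.
    case: eqP => _; last exact: regular_const.
    by exists E.+1; apply: polyf_scale; apply: pg.
  have rCX a : forall i' j', regular s (fun x => (C x ^+ a) i' j').
    elim: a => [|a IH] i' j'.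
      apply: (@regular_ext _ _ _ (fun=> (1 : 'M[k]_E.+1) i' j')).
        exact: regular_const.
      by move=> x; rewrite expr0.
    apply: (@regular_ext _ _ _ (fun x => \sum_l C x i' l * (C x ^+ a) l j')).
      by apply: regular_sum => l; apply: regular_mul.
    by move=> x; rewrite exprS [in RHS]mxE.
  apply: (@regular_ext _ _ _ (fun x => \sum_(l < e.+1) c l x * (C x ^+ l) i j)).
    apply: regular_sum => l; apply: regular_mul => //.
    by exists (e - l)%N; apply: pc; rewrite -ltnS.
  move=> x; rewrite /Gp poly_def rmorph_sum summxE; apply: eq_bigr => l _.
  rewrite -mul_polyC rmorphM /= horner_mx_C rmorphXn /= horner_mx_X.
  by rewrite -mulmxE mul_scalar_mx mxE.
- move=> x Zx; apply/eqP/det0P.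
  have : eigenvalue (C x) (x 0 i0).
    by rewrite eigenvalue_root_char charC /root FE gZ.
  case/eigenvalueP => v vC v0; exists v => //.
  by rewrite (eigenvector_horner_mx _ vC) horner_poly -GE GZ // scale0r.
(* Without common roots there is a Bezout relation. Evaluated at [C q], where [F q] vanishes by
   Cayley-Hamilton, it inverts the matrix defining [h q]. *)
- have : coprimep (F q) (Gp q).
    apply: Pdiv.ClosedField.root_coprimep => t Ft.
    have tr : t \in r.
      by move: Ft; rewrite Fq rootZ ?root_prod_XsubC // (monicP (monF q)) oner_neq0.
    have := Gr _ (map_f upd tr); rewrite GE horner_poly mxE eqxx.
    rewrite (eq_bigr (fun j : 'I__ => c j q * t ^+ j)) // => j _.
    by rewrite (polyf_agree (pc j _) (upd_q t)) // -ltnS.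
  case/Bezout_eq1_coprimepP => -[u v] /(congr1 (horner_mx (C q))).
  rewrite rmorphD !rmorphM /= -{1}(charC q) Cayley_Hamilton mulr0 add0r rmorph1.
  move/(congr1 determinant); rewrite det_mulmx det1 => vG.
  by apply/eqP => h0; move/eqP: vG; rewrite -/(h q) h0 mulr0 eq_sym oner_eq0.
Qed.
End Projection.
End Elimination.

(** * Growth of the Hilbert function of a cone *)

Lemma leq_expn2r m n e : (m <= n)%N -> (m ^ e <= n ^ e)%N.
Proof. by case: e => // e; rewrite leq_exp2r. Qed.

Section HilbertFunction.
Variables (k : closedFieldType) (n : nat) (Z : 'rV[k]_n -> Prop).

Definition spans (J : finType) (h : J -> 'rV[k]_n -> k) (f : 'rV[k]_n -> k) :=
  exists a : J -> k, forall x, Z x -> f x = \sum_j a j * h j x.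

(** A bound on the dimension of the space of restrictions to [Z], stated through a spanning family
    so that no quotient space has to be built. The spanning functions may be arbitrary. *)
Definition hilbert_le s e N := exists (J : finType) (h : J -> 'rV[k]_n -> k),
  (#|J| <= N)%N /\ forall f, polyf false s e f -> spans h f.

Definition hilbert_growth s b :=
  exists K, forall e, hilbert_le s e (K * e.+1 ^ b).

(** The products of a spanning function for the coefficients with one of the [M] powers of the new
    coordinate span. This serves both the free and the integral case. *)
Lemma hilbert_le_powers s (i0 : 'I_n) e e' M N N' :
  hilbert_le s e' N -> (N * M <= N')%N ->
  (forall f, polyf false s.+1 e f -> exists g : nat -> 'rV[k]_n -> k,
    (forall j, (j < M)%N -> polyf false s e' (g j)) /\
    forall x, Z x -> f x = \sum_(j < M) g j x * x 0 i0 ^+ j) ->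
  hilbert_le s.+1 e N'.
Proof.
move=> [J [h [cardJ hJ]]] leN' fg.
exists (J * 'I_M)%type, (fun (u : J * 'I_M) x => h u.1 x * x 0 i0 ^+ u.2); split.
  by rewrite card_prod card_ord (leq_trans _ leN') ?leq_mul.
move=> f /fg[g [pg fE]].
have [a gE] := fin_all_exists (fun j : 'I_M => hJ _ (pg j (ltn_ord j))).
exists (fun u => a u.2 u.1) => x Zx.
rewrite fE // -(pair_bigA _ (fun i j => a j i * (h i x * x 0 i0 ^+ j))) /=.
rewrite exchange_big; apply: eq_bigr => j _; rewrite gE // mulr_suml.
by apply: eq_bigr => i _; rewrite mulrA.
Qed.

Lemma hilbert_growth0 : hilbert_growth 0 0.
Proof.
exists 1%N => e; exists unit, (fun _ _ => 1); split.
  by rewrite card_unit.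
move=> f pf; exists (fun=> f 0) => x _.
by rewrite big_const card_unit /= addr0 mulr1; apply: polyf_agree pf _.
Qed.

Lemma hilbert_growth_free s b : (s < n)%N ->
  hilbert_growth s b -> hilbert_growth s.+1 b.+1.
Proof.
move=> lt_sn [K hK]; exists K => e.
apply: (hilbert_le_powers (i0 := Ordinal lt_sn) (M := e.+1) (hK e)).
  by rewrite expnSr mulnA.
move=> f /(polyf_coefs (erefl _ : Ordinal lt_sn = s :> nat))[g [pg fE]].
exists g; split=> // j lt_j; apply: polyf_le (leq_subr j _); exact: pg.
Qed.

(** Division by the monic equation leaves [E.+1] powers whatever [e] is; each multiplication by a
    coordinate raises the degree of the coefficients by at most [E.+1]. *)
Lemma polyf_reduce s (i0 : 'I_n) E g e f : i0 = s :> nat ->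
  (forall j, (j < E.+1)%N -> polyf false s E.+1 (g j)) ->
  (forall x, Z x -> x 0 i0 ^+ E.+1 + \sum_(j < E.+1) g j x * x 0 i0 ^+ j = 0) ->
  polyf false s.+1 e f ->
  exists G : nat -> 'rV[k]_n -> k,
    (forall j, polyf false s (E.+1 * e) (G j)) /\
    forall x, Z x -> f x = \sum_(j < E.+1) G j x * x 0 i0 ^+ j.
Proof.
move=> i0s pg gZ; elim=> {e f} [e a _|i e f lt_is _ [G [pG fE]]
  |e f f' _ [G [pG fE]] _ [G' [pG' fE']]|e f f' _ [G [pG fE]] ff'].
- exists (fun j x => if j == 0%N then a else 0); split.
    by case=> [|j]; apply: polyf_const.
  by move=> x _; rewrite big_ord_recl big1 ?addr0 ?mulr1 // => j _; rewrite mul0r.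
- have [/eqP is0|is0] := boolP (i == s :> nat); last first.
    exists (fun j (x : 'rV[k]_n) => x 0 i * G j x); split.
      move=> j; have lt_i : (i < s)%N by lia.
      by apply: polyf_le (polyf_coord lt_i (pG j)) _; lia.
    move=> x Zx; rewrite fE // mulr_sumr.
    by apply: eq_bigr => j _; rewrite mulrA.
  have -> : i = i0 by apply: val_inj; rewrite /= is0.
  (* Multiplication by the coordinate shifts the coefficients; the overflow [G E x * x 0 i0 ^+ E.+1]
     is rewritten by the monic equation. *)
  exists (fun j x => (if j is j'.+1 then G j' x else 0)
     + -1 * (if (j < E.+1)%N then G E x * g j x else 0)); split.
    move=> j; apply: polyf_add.
      case: j => [|j]; first exact: polyf0.
      by apply: polyf_le (pG j) _; lia.
    apply: polyf_scale; case: (ltnP j E.+1) => [lt_j|_]; last exact: polyf0.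
    by apply: polyf_le (polyf_mul (pG E) (pg j lt_j)) _; lia.
  move=> x Zx; rewrite [RHS](eq_bigr (fun j : 'I_E.+1 =>
      (if j : nat is j'.+1 then G j' x else 0) * x 0 i0 ^+ j
      - G E x * (g j x * x 0 i0 ^+ j))); last first.
    by move=> j _; rewrite ltn_ord mulrDl mulN1r mulNr -(mulrA (G E x)).
  rewrite sumrB -mulr_sumr.
  have -> : \sum_(j < E.+1) g j x * x 0 i0 ^+ j = - x 0 i0 ^+ E.+1.
    by apply/eqP; rewrite -addr_eq0 addrC gZ.
  rewrite mulrN opprK fE // mulr_sumr [in RHS]big_ord_recl /= mul0r add0r.
  rewrite [in LHS]big_ord_recr /=.
  congr (_ + _); last by rewrite mulrCA exprS.
  by apply: eq_bigr => j _; rewrite mulrCA exprS.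
- exists (fun j x => G j x + G' j x); split.
    by move=> j; apply: polyf_add.
  move=> x Zx; rewrite fE // fE' // -big_split.
  by apply: eq_bigr => j _; rewrite mulrDl.
- by exists G; split=> // x; rewrite -ff'; apply: fE.
Qed.

Lemma hilbert_growth_integral s b (i0 : 'I_n) E g : i0 = s :> nat ->
  (forall j, (j < E.+1)%N -> polyf false s E.+1 (g j)) ->
  (forall x, Z x -> x 0 i0 ^+ E.+1 + \sum_(j < E.+1) g j x * x 0 i0 ^+ j = 0) ->
  hilbert_growth s b -> hilbert_growth s.+1 b.
Proof.
(* The factor [E.+1 ^ b] absorbs the growth of the degree to [E.+1 * e], the last factor counts the
   powers. *)
move=> i0s pg gZ [K hK]; exists (K * E.+1 ^ b * E.+1)%N => e.
apply: (hilbert_le_powers (i0 := i0) (M := E.+1) (hK (E.+1 * e)%N)).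
  have : ((E.+1 * e).+1 ^ b <= E.+1 ^ b * e.+1 ^ b)%N.
    by rewrite -expnMn leq_expn2r //; lia.
  by nia.
move=> f /(polyf_reduce i0s pg gZ)[G [pG fE]].
by exists G.
Qed.

(* Noether normalization: Z is finite over the first c coordinates. *)
Lemma hilbert_growth_cone c : Z 0 -> (forall a x, Z x -> Z (a *: x)) ->
  closed_image Z n -> (c <= n)%N ->
  (forall x, Z x -> agree c x 0 -> x = 0) -> hilbert_growth n c.
Proof.
move=> Z0 Zcone clZ le_cn ZL.
have growth s : (s <= c)%N -> hilbert_growth s s.
  elim: s => [|s IH] lt_sc; first exact: hilbert_growth0.
  by apply: hilbert_growth_free (IH (ltnW lt_sc)); apply: leq_trans le_cn.
have ZLs s (i0 : 'I_n) x : (c <= s)%N -> i0 = s :> nat ->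
    Z x -> agree s x 0 -> x 0 i0 = 0.
  move=> le_cs _ Zx x0; rewrite (ZL x Zx) ?mxE // => i lt_ic.
  by apply: x0; apply: leq_trans le_cs.
(* Descent from [n] to [c], removing one integral coordinate at a time. *)
have clZs s : (c <= s <= n)%N -> closed_image Z s.
  move=> /andP[le_cs le_sn]; rewrite -(subKn le_sn).
  have : (n - s <= n - c)%N by lia.
  elim: (n - s)%N => [|t IH] lt_t; first by rewrite subn0.
  have lt_n : (n - t.+1 < n)%N by lia.
  have e1 : (n - t = (n - t.+1).+1)%N by lia.
  have {IH} := IH (ltnW lt_t); rewrite e1 => cl.
  pose i0 := Ordinal lt_n.
  have ZLi : forall x, Z x -> agree (n - t.+1) x 0 -> x 0 i0 = 0.
    by move=> x; apply: (ZLs (n - t.+1)%N) => //; lia.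
  have [E [g [pg gZ]]] := coordinate_integral (i0 := i0) (erefl _) ZLi cl.
  exact: closed_image_step pg gZ cl.
(* Ascent from [c] to [n]: integral coordinates do not change the exponent [c]. *)
have growth2 t : (c + t <= n)%N -> hilbert_growth (c + t) c.
  elim: t => [|t IH] lt_n; first by rewrite addn0; apply: growth.
  rewrite addnS in lt_n *; pose i0 := Ordinal lt_n.
  have ZLi : forall x, Z x -> agree (c + t) x 0 -> x 0 i0 = 0.
    by move=> x; apply: (ZLs (c + t)%N) => //; lia.
  have cl : closed_image Z (c + t).+1 by apply: clZs; lia.
  have [E [g [pg gZ]]] := coordinate_integral (i0 := i0) (erefl _) ZLi cl.
  by apply: hilbert_growth_integral pg gZ _ => //; apply: IH; lia.
by have := growth2 (n - c)%N; rewrite subnKC //; apply.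
Qed.

End HilbertFunction.

(** * The cone of matrices of bounded rank *)

Lemma sum_digits B D m : (m < B ^ D)%N ->
  (\sum_(i < D) (m %/ B ^ i %% B) * B ^ i = m)%N.
Proof.
elim: D m => [|D IH] m lt_m; first by rewrite big_ord0; case: m lt_m.
have B_gt0 : (0 < B)%N by case: B lt_m {IH} => //; rewrite exp0n.
rewrite big_ord_recl expn0 divn1 muln1 [RHS](divn_eq m B) addnC; congr (_ + _)%N.
rewrite -[in RHS](IH (m %/ B)%N) ?ltn_divLR ?big_distrl -?expnSr //=.
by apply: eq_bigr => i _; rewrite expnS divnMA -mulnA (mulnC B).
Qed.

(* Kronecker substitution: the variable i is replaced by t^(B^i). *)
Lemma monomials_free (k : closedFieldType) (I : finType) B
    (u : 'I_(B ^ #|I|) -> k) : (exists m, u m != 0) ->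
  exists z : I -> k,
    \sum_m u m * \prod_i z i ^+ (m %/ B ^ enum_rank i %% B) != 0.
Proof.
move=> [m0 um0]; pose U := \sum_m u m *: 'X^m.
have Um0 : U`_m0 = u m0.
  rewrite coef_sum (bigD1 m0) //= big1 ?addr0 => [|m ne_m].
    by rewrite coefZ coefXn eqxx mulr1.
  by rewrite coefZ coefXn eq_sym (inj_eq val_inj) (negPf ne_m) mulr0.
have : U != 0 by apply: contraNneq um0 => U0; rewrite -Um0 U0 coef0.
move=> /closed_nonrootP[t]; rewrite /root horner_sum => Ut.
exists (fun i => t ^+ (B ^ enum_rank i)).
rewrite (_ : \sum_m _ = \sum_m (u m *: 'X^m).[t]) //.
apply: eq_bigr => m _; rewrite hornerZ hornerXn; congr (_ * _).
rewrite -[X in _ = _ ^+ X](sum_digits (ltn_ord m)) -prodrXr.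
rewrite [RHS](reindex (@enum_rank I)) /=; last first.
  by apply: onW_bij; apply: enum_rank_bij.
by apply: eq_bigr => i _; rewrite mulnC exprM.
Qed.

Lemma polyf_linear_mx (k : fieldType) hom n r m
    (G : {linear 'rV[k]_n -> 'M[k]_(r, m)}) i j :
  polyf hom n 1 (fun y => G y i j).
Proof.
apply: (@polyf_ext _ _ _ _ _ (fun y => \sum_l y 0 l * G (delta_mx 0 l) i j)).
  by apply: polyf_sum => l _; apply: polyf_coord => //; apply: polyf_const; left.
move=> y; rewrite [in RHS](row_sum_delta y) linear_sum summxE.
by apply: eq_bigr => l _; rewrite linearZ mxE.
Qed.

Section RankLocus.
Variables (k : closedFieldType) (n d : nat).

(** The determinant below is a combination of minors of size [d.+1], so it vanishes in rank at most
    [d]. [A] and [B] come from the Gaussian decomposition of [G q] and turn it into the identity. *)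
Lemma closed_rank_locus r m (G : {linear 'rV[k]_n -> 'M[k]_(r, m)}) :
  closed_image (fun y => (\rank (G y) <= d)%N) n.
Proof.
move=> q nq; have lt_d : (d < \rank (G q))%N.
  by rewrite ltnNge; apply/negP => /nq; apply=> i _.
have le_r := leq_trans lt_d (rank_leq_row _).
have le_m := leq_trans lt_d (rank_leq_col _).
pose A : 'M[k]_(d.+1, r) := pid_mx d.+1 *m invmx (col_ebase (G q)).
pose B : 'M[k]_(m, d.+1) := invmx (row_ebase (G q)) *m pid_mx d.+1.
exists d, (fun y => \det (A *m G y *m B)); split.
- have := @polyf_det k n true n 1 d.+1 (fun y => A *m G y *m B).
  rewrite muln1; apply=> i j.
  exact: (polyf_linear_mx _ (mulmxr B \o mulmx A \o G)).
- move=> y rk_y; apply/eqP; apply: contraTT isT => nz.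
  have : A *m G y *m B \in unitmx by rewrite unitmxE unitfE.
  move/mxrank_unit => rkE.
  have := leq_trans (mxrankM_maxl _ B) (mxrankM_maxr A (G y)).
  by rewrite rkE leqNgt ltnS rk_y.
- suff -> : A *m G q *m B = 1%:M by rewrite det1 oner_neq0.
  rewrite -[in LHS](mulmx_ebase (G q)) /A /B !mulmxA mulmxKV ?col_ebase_unit //.
  rewrite mulmxK ?row_ebase_unit // !mul_pid_mx -[RHS]pid_mx_1.
  by congr pid_mx; lia.
Qed.

(** If [c] were smaller than the number [D] of chosen entries, the bound of order [e ^ c] would
    force a linear relation on the locus between monomials in these entries; but the entries take
    generic values there independently. *)
Lemma rank_locus_codim r m c (G : {linear 'rV[k]_n -> 'M[k]_(d + r, d + m)}) :
  (forall X, exists y, G y = X) -> (c <= n)%N ->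
  (forall y, (\rank (G y) <= d)%N -> agree c y 0 -> y = 0) ->
  ((d + r) * d + d * m <= c)%N.
Proof.
move=> Gsurj le_cn GL.
have [||K hK] := hilbert_growth_cone _ _ (@closed_rank_locus _ _ G) le_cn GL.
- by rewrite linear0 mxrank0.
- by move=> a x; apply: leq_trans; rewrite linearZ mxrank_scale.
pose I := ('I_(d + r) * 'I_d + 'I_d * 'I_m)%type.
have cardI : #|{: I}| = ((d + r) * d + d * m)%N.
  by rewrite card_sum !card_prod !card_ord.
rewrite -cardI leqNgt; apply/negP => lt_cD; set D := #|{: I}| in lt_cD.
(* Chosen so that [K * (D * b).+1 ^ c <= b * B ^ c < B ^ c.+1 <= B ^ D]: fewer spanning functions
   than monomials with all exponents at most [b]. *)
pose b := (K * D ^ c)%N; pose B := b.+1.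
pose w (i : I) (X : 'M[k]_(d + r, d + m)) := match i with
  | inl u => X u.1 (lshift m u.2) | inr u => X (lshift r u.1) (rshift d u.2) end.
pose mon (z : I -> k) (l : 'I_(B ^ D)) :=
  \prod_i z i ^+ (l %/ B ^ enum_rank i %% B).
have pmon l : polyf false n (D * b) (fun y => mon (w^~ (G y)) l).
  have pw i : polyf false n ((l %/ B ^ enum_rank i %% B) * 1)
      (fun y => w i (G y) ^+ (l %/ B ^ enum_rank i %% B)).
    by apply: polyf_exp; case: i => u; apply: polyf_linear_mx.
  apply: polyf_le (polyf_prod _ pw) _; rewrite -sum_nat_const.
  by apply: leq_sum => i _; rewrite muln1 -ltnS ltn_mod.
have [J [h [cardJ hJ]]] := hK (D * b)%N.
have [a aE] := fin_all_exists (fun l => hJ _ (pmon l)).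
have lt_J : (#|J| < B ^ D)%N.
  apply: leq_ltn_trans cardJ _; apply: (@leq_trans (B ^ c.+1)); last first.
    by rewrite leq_pexp2l.
  apply: (@leq_ltn_trans (K * (D * B) ^ c)).
    by rewrite leq_mul2l leq_expn2r ?orbT // /B; nia.
  by rewrite expnMn mulnA -/b expnS ltn_mul2r expn_gt0 /= ltnS leqnn.
(* More rows than columns, so a nonzero [v] in the left kernel gives a relation between the
   monomials on the locus. *)
pose M := \matrix_(l < B ^ D, j < #|J|) a l (enum_val j).
have [v vM v0] : exists2 v : 'rV_(B ^ D), v *m M = 0 & v != 0.
  have : kermx M != 0.
    by rewrite kermx_eq0 /row_free neq_ltn (leq_ltn_trans (rank_leq_col M)).
  case/rowV0Pn => v /sub_kermxP vM v0; by exists v.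
have vmon y : (\rank (G y) <= d)%N -> \sum_l v 0 l * mon (w^~ (G y)) l = 0.
  move=> rk_y; under eq_bigr => l _ do rewrite aE // mulr_sumr.
  rewrite exchange_big big1 //= => j _.
  under eq_bigr => l _ do rewrite mulrA.
  rewrite -mulr_suml.
  have := congr1 (fun N : 'rV_#|J| => N 0 (enum_rank j)) vM; rewrite !mxE.
  under eq_bigr => l _ do rewrite mxE enum_rankK.
  by move->; rewrite mul0r.
have [z0 z0v] : exists z, \sum_l v 0 l * mon z l != 0.
  apply: (@monomials_free k I B (v 0)).
  by have /rV0Pn[l] := v0; exists l.
(* Both Q, which gives the linear relation v, and R, which gives the determinant
   of the top left block, are nonzero on the line from z0 to z1. *)
pose z1 (i : I) : k := if i is inl u then (u.1 == lshift r u.2)%:R else 0.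
pose zt i : {poly k} := (z0 i)%:P + 'X * (z1 i - z0 i)%:P.
pose Q := \sum_l v 0 l *: \prod_i zt i ^+ (l %/ B ^ enum_rank i %% B).
pose R := \det (\matrix_(i < d, j < d) zt (inl (lshift r i, j))).
have QE t : Q.[t] = \sum_l v 0 l * mon (fun i => (zt i).[t]) l.
  rewrite horner_sum; apply: eq_bigr => l _; rewrite hornerZ horner_prod.
  by congr (_ * _); apply: eq_bigr => i _; rewrite horner_exp.
have RE t : R.[t] = \det (\matrix_(i < d, j < d) (zt (inl (lshift r i, j))).[t]).
  rewrite -horner_evalE -det_map_mx; congr determinant.
  by apply/matrixP => i j; rewrite !mxE.
have Q0 : Q != 0.
  apply: contraNneq z0v => Q0; rewrite -[X in _ == X](horner0 0) -Q0 QE.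
  apply/eqP; apply: eq_bigr => l _; congr (_ * _); apply: eq_bigr => i _.
  by rewrite !hornerE.
have R0 : R != 0.
  apply: contraTneq isT => R0; have := RE 1; rewrite R0 horner0.
  rewrite (_ : \matrix_(i, j) _ = 1%:M) ?det1 => [/esym/eqP|].
    by rewrite oner_eq0.
  apply/matrixP => i j; rewrite !mxE !hornerE /= addrC addKr.
  by rewrite (inj_eq (@lshift_inj _ _)).
have /closed_nonrootP[t] : Q * R != 0 by rewrite mulf_neq0.
rewrite /root hornerM mulf_eq0 negb_or => /andP[Qt Rt].
pose z i := (zt i).[t].
pose P1 := \matrix_(i < d + r, j < d) z (inl (i, j)).
pose P2 := \matrix_(i < d, j < m) z (inr (i, j)).
have unitP : usubmx P1 \in unitmx.
  rewrite unitmxE unitfE; move: Rt; rewrite RE; congr (\det _ != 0).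
  by apply/matrixP => i j; rewrite !mxE.
(* A matrix with invertible top left block and rank at most [d] is determined by its first [d]
   columns and rows; this product realizes the prescribed entries. *)
have [y yE] := Gsurj (P1 *m row_mx 1%:M (invmx (usubmx P1) *m P2)).
have wz i : w i (G y) = z i.
  rewrite yE mul_mx_row mulmx1; case: i => [[i j]|[i j]] /=.
    by rewrite row_mxEl mxE.
  rewrite row_mxEr -[X in (X *m (_ *m P2)) _ _]vsubmxK mul_col_mx col_mxEu.
  rewrite mulmxA mulmxV //.
  by rewrite mul1mx mxE.
have rk_y : (\rank (G y) <= d)%N.
  by rewrite yE (leq_trans (mxrankM_maxl _ _)) ?rank_leq_col.
case/eqP: Qt; rewrite QE -[RHS](vmon y rk_y); apply: eq_bigr => l _; congr (_ * _).
by apply: eq_bigr => i _; rewrite wz.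
Qed.

End RankLocus.

(** * The kernel of psi *)

Section Psi.
Variables (k : fieldType) (r m n d : nat) (A : 'I_r -> 'M[k]_(m, n)).

Fact psi_is_linear : linear (psi A).
Proof.
move=> a X Y; rewrite /psi scaler_sumr -big_split; apply: eq_bigr => i _.
by rewrite linearP mulmxDl -scalemxAl.
Qed.
HB.instance Definition _ :=
  GRing.isLinear.Build k 'M[k]_(r, m) 'rV[k]_n *:%R (psi A) psi_is_linear.

(** A rank factorization puts [X] in the tensor product of [M_1] with a subspace of dimension
    exactly [d]: [V] keeps [d] independent columns of [col_ebase X] even when the rank is smaller,
    and [Y] is filled up with zero rows. *)
Lemma rep_proj_rank X : (d <= r)%N -> rep_proj d A ->
  (\rank X <= d)%N -> psi A X = 0 -> X = 0.
Proof.
move=> le_dr projA rkX; pose V : 'M_(d, r) := (col_ebase X *m pid_mx d)^T.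
pose Y : 'M_(d, m) := pid_mx (\rank X) *m row_ebase X.
have <- : V^T *m Y = X.
  rewrite trmxK /Y mulmxA -(mulmxA (col_ebase X)) mul_pid_mx -[RHS]mulmx_ebase.
  by congr (_ *m pid_mx _ *m _); lia.
have freeV : row_free V.
  rewrite /row_free mxrank_tr eqmxMfull ?row_full_unit ?col_ebase_unit //.
  by rewrite rank_pid_mx.
by move/(projA _ freeV) ->; rewrite mulmx0.
Qed.

End Psi.

(** * Linear spaces of matrices whose nonzero elements have rank greater than [d] *)

Section SubspacesOfLargeRank.
Import VectorInternalTheory.

(** The codimension of [W] is at least [(d + r) * d + d * m], which leaves [r * m] out of
    [(d + r) * (d + m)]. *)
Lemma dimv_rank_gt (k : closedFieldType) (d r m : nat)
    (W : {vspace 'M[k]_(d + r, d + m)}) :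
  (forall X, X \in W -> (\rank X <= d)%N -> X = 0) -> (\dim W <= r * m)%N.
Proof.
move=> Wgt; pose N := ((d + r) * (d + m))%N.
(* [W] is the kernel of [C]. In the coordinates given by [col_ebase C], it is cut out by the first
   [\rank C] of them; [G] goes back from these coordinates to matrices. *)
pose C := cokermx (vs2mx W); pose B := invmx (col_ebase C).
have unitB : B \in unitmx by rewrite unitmx_inv col_ebase_unit.
pose G : {linear 'rV[k]_N -> 'M[k]_(d + r, d + m)} := r2v \o mulmxr B.
have Gsurj X : exists y, G y = X.
  by exists (v2r X *m col_ebase C); rewrite /= mulmxK ?col_ebase_unit // v2rK.
have leN := rank_leq_row (vs2mx W).
have := @rank_locus_codim k N d r m (\rank C) G Gsurj (rank_leq_row C).
have GW y : (\rank (G y) <= d)%N -> agree (\rank C) y 0 -> y = 0.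
  move=> rk_y y0; suff GyW : G y \in W.
    have yB : y *m B = 0 by rewrite -(r2vK (y *m B)) [r2v _](Wgt _ GyW) ?linear0.
    by rewrite -[y](mulmxK unitB) yB mul0mx.
  rewrite [_ \in _](genmxE (v2r (G y))) r2vK submxE -/C.
  rewrite -[C in _ *m C]mulmx_ebase !mulmxA mulmxKV ?col_ebase_unit //.
  suff yC p : y *m (pid_mx (\rank C) : 'M_(_, p)) = 0 by rewrite yC mul0mx.
  apply/rowP => j; rewrite !mxE big1 // => i _; rewrite mxE.
  case: (ltnP i (\rank C)) => [/y0->|_]; rewrite ?mxE ?mul0r //.
  by rewrite andbF mulr0.
move/(_ GW); rewrite mxrank_coker -/(\dim W) in leN *.
by move: leN; rewrite dim_matrix; nia.
Qed.

End SubspacesOfLargeRank.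

Theorem theorem2p3p2 (k : closedFieldType) (r d m n : nat)
  (A : 'I_r -> 'M[k]_(m, n)) :
  (2 <= r)%N -> (1 <= d)%N -> (d <= r - 1)%N ->
  rep_proj d A ->
  (\dim (lker (linfun (psi A))) <= (r - d) * (m - minn m d))%N /\
  ((((r - d) * minn m d)%N)%:Z <= Delta m n d)%R.
Proof.
move=> _ _ le_d projA; have {le_d} le_dr : (d <= r)%N by lia.
have ker_gt X : X \in lker (linfun (psi A)) -> (\rank X <= d)%N -> X = 0.
  rewrite memv_ker lfunE => /eqP psiX rkX.
  exact: (rep_proj_rank le_dr projA rkX psiX).
have ker_le : (\dim (lker (linfun (psi A))) <= (r - d) * (m - minn m d))%N.
  (* For [m < d] every matrix has rank at most [d], so the kernel is zero; otherwise [r] and [m] are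
     written as [d] plus a remainder. *)
  have [lt_md|le_dm] := ltnP m d.
    rewrite (_ : lker _ = 0%VS) ?dimv0 //; apply/eqP; rewrite -subv0.
    apply/subvP => X /ker_gt-> //; first exact: mem0v.
    by rewrite (leq_trans (rank_leq_col X)) // ltnW.
  move: A projA ker_gt; rewrite -(subnKC le_dr) -(subnKC le_dm) => A' _ ker_gt.
  by rewrite addKn; apply: leq_trans (dimv_rank_gt ker_gt) _; rewrite leq_mul2l; lia.
split=> //.
(* By rank and nullity, [n] is at least [r * m] minus the kernel bound; subtracting [d * m] leaves
   [(r - d) * minn m d]. *)
have dim_ker_img : (\dim (lker (linfun (psi A))) + \dim (limg (linfun (psi A)))
    = r * m)%N.
  by have := limg_ker_dim (linfun (psi A)) fullv; rewrite capfv dimvf.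
have dim_img : (\dim (limg (linfun (psi A))) <= n)%N.
  by have := dimvS (subvf (limg (linfun (psi A)))); rewrite dimvf /dim /= mul1n.
rewrite /Delta; have [s rE] : exists s, r = (d + s)%N by exists (r - d)%N; lia.
have [t mE] : exists t, m = (minn m d + t)%N by exists (m - minn m d)%N; lia.
have sE : (r - d = s)%N by lia.
have tE : (m - minn m d = t)%N by lia.
rewrite sE tE in ker_le *; rewrite lerBrDr -PoszD lez_nat.
by apply: leq_trans dim_img; nia.
Qed.
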